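(* Let $G$ be a simple connected graph with $n$ nodes and $m$ edges, let $q$ be a positive integer, and let $R_q(G)$ be the $q$-triangulation graph of $G$ with node set $\tilde V=V\cup V'$. Let $T_{ij}$ and $\tilde T_{ij}$ denote hitting times in $G$ and in $R_q(G)$, respectively. Then: 1) if $i,j\in V$, then $\tilde T_{ij}=\frac{4q+2}{q+2}T_{ij}$; 2) if $i\in V'$, $j\in V$ and $\tilde\Gamma(i)=\{s,t\}$, then $$\tilde T_{ij}=1+\frac{2q+1}{q+2}(T_{sj}+T_{tj}),$$ $$\tilde T_{ji}=m(2q+1)-1+\frac{2q+1}{2(q+2)}\big[2(T_{js}+T_{jt})-(T_{ts}+T_{st})\big];$$ 3) if $i,j\in V'$ with $i\ne j$, $\tilde\Gamma(i)=\{s,t\}$ and $\tilde\Gamma(j)=\{u,v\}$, then $$\tilde T_{ij}=m(2q+1)+\frac{2q+1}{2(q+2)}\big[T_{su}+T_{tu}+T_{sv}+T_{tv}-(T_{uv}+T_{vu})\big].$$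
   Context: For a positive integer $q$, the $q$-triangulation graph $R_q(G)$ is obtained from $G$ by keeping all nodes and edges of $G$ and adding, for each edge $uv$ of $G$, $q$ disjoint paths of length $2$: $ux_1v,\dots,ux_qv$, where $x_1,\dots,x_q$ are new nodes. $V$ is the set of old nodes (those of $G$) and $V'$ the set of the $mq$ new nodes; $\tilde\Gamma(x)$ is the set of neighbors of $x$ in $R_q(G)$ (for a new node $x$ created for the edge $uv$, $\tilde\Gamma(x)=\{u,v\}$). The random walk on a graph is the discrete-time simple unbiased one: from node $i$ it moves to each neighbor with probability $1/d_i$, where $d_i$ is the degree of $i$. The hitting time $T_{ij}$ is the expected number of steps needed for the walker started at $i$ to first reach $j$ (so $T_{ii}=0$). *)

(* Defs.v *)
From HB Require Import structures.
From mathcomp Require Import all_boot all_order all_algebra.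
From mathcomp Require Import all_classical all_reals all_analysis.

Set Implicit Arguments.
Unset Strict Implicit.
Unset Printing Implicit Defensive.

Import Order.TTheory GRing.Theory Num.Theory.

Local Open Scope ring_scope.

Record sgraph := SGraph {
  vertex :> finType;
  adj : rel vertex;
  adj_sym : symmetric adj;
  adj_irr : irreflexive adj }.

Definition connected_graph (G : sgraph) : Prop :=
  forall x y : G, connect (@adj G) x y.

Definition neighbors (G : sgraph) (x : G) : {set G} := [set y | adj x y].

Definition degree (G : sgraph) (x : G) : nat := #|neighbors x|.

Definition edges (G : sgraph) : {set {set G}} :=
  [set [set x; y] | x in G, y in G & adj x y].

(* New nodes are pairs (e, k) with e an edge and k < q: (e, k) is the middle
   node of the k-th path of length 2 added between the endpoints of e. *)
Definition new_node (q : nat) (G : sgraph) : finType :=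
  ({e : {set G} | e \in edges G} * 'I_q)%type.

Definition tri_adj (q : nat) (G : sgraph) : rel (G + new_node q G) :=
  fun x y => match x, y with
  | inl u, inl v => adj u v
  | inl u, inr p => u \in val p.1
  | inr p, inl v => v \in val p.1
  | inr _, inr _ => false
  end.

Lemma tri_adj_sym (q : nat) (G : sgraph) : symmetric (@tri_adj q G).
Proof. by move=> [u|p] [v|r] //=; exact: adj_sym. Qed.

Lemma tri_adj_irr (q : nat) (G : sgraph) : irreflexive (@tri_adj q G).
Proof. by move=> [u|p] //=; exact: adj_irr. Qed.

Definition triangulation (q : nat) (G : sgraph) : sgraph :=
  SGraph (@tri_adj_sym q G) (@tri_adj_irr q G).

Definition old_vertex {q : nat} {G : sgraph} (x : G) : triangulation q G :=
  inl x.

Definition new_vertex {q : nat} {G : sgraph} (p : new_node q G) :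
    triangulation q G :=
  inr p.

Definition step_prob (R : realType) (G : sgraph) (x y : G) : R :=
  if adj x y then (degree x)%:R^-1 else 0.

(* Probability that the walk started at x makes w its first [size w] steps. *)
Fixpoint walk_prob (R : realType) (G : sgraph) (x : G) (w : seq G) : R :=
  if w is y :: w' then step_prob R x y * walk_prob R y w' else 1.

(* P_i(tau_j = k), where tau_j is the first time the walk is at j: the
   trajectory i :: w ends at j and does not visit j before. *)
Definition hit_prob (R : realType) (G : sgraph) (i j : G) (k : nat) : R :=
  \sum_(w : k.-tuple G | (last i w == j) && (j \notin belast i w))
    walk_prob R i w.

(* E_i[tau_j], with tau_j valued in {0, 1, 2, ...} U {+oo}. The last summand is
   +oo * P_i(tau_j = +oo), and is 0 when this probability is 0. *)
Definition hitting_time (R : realType) (G : sgraph) (i j : G) : \bar R :=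
  (\sum_(0 <= k <oo) (k%:R%:E * (hit_prob R i j k)%:E)
   + +oo * (1 - \sum_(0 <= k <oo) (hit_prob R i j k)%:E))%E.

(* Main.v *)
Require Import Defs.
From HB Require Import structures.
From mathcomp Require Import all_boot all_order all_algebra.
From mathcomp Require Import all_classical all_reals all_analysis.
From mathcomp Require Import ring lra.

(** The hitting times to a fixed target [j] satisfy the first-step equations: the
    value is 0 at [j], and elsewhere it is 1 plus the average over the neighbours.
    Conversely any real solution [f] of these equations is the hitting time
    ([hitting_timeE]), so the proof amounts to exhibiting solutions on the
    triangulation.

    On the connected graph [G], a solution exists because the linear system is
    injective by the maximum principle ([first_step_exists]); this makes all
    hitting times in [G] finite.

    On the triangulation, a walk at a new node has to step to one of its two
    endpoints, so the equations determine the values at new nodes from the values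
    at old vertices ([tri_ext]). After this elimination the equation at an old
    vertex is the one of [G] with the constant 1 replaced by
    [c = (4q + 2) / (q + 2)]. For an old target, [c] times the hitting time of [G]
    solves it ([tri_ext_old_target]). For a new target with endpoints [s] and [t],
    the solution is a constant plus [c / 2] times the sum of the hitting times to
    [s] and [t] in [G] ([tri_ext_new_target]): the equation fails for that sum
    only at [s] and [t], where the defect is the mean return time
    [2 m / degree] ([sum_adj_target], [handshake]), and this is what the
    missing detour through the target compensates. *)

Set Implicit Arguments.
Unset Strict Implicit.
Unset Printing Implicit Defensive.

Import Order.TTheory GRing.Theory Num.Theory.

Local Open Scope ring_scope.

(** * Hitting times as solutions of the first-step equations *)

(** Turns quantitative bounds on partial sums into the value of an
    extended-real series. The error bound is only asked along the indices
    [N n], in the multiplied form [n * error <= C]: this is the shape in which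
    the tail estimates for hitting times come out. *)
Lemma eseries_squeeze (R : realType) (a : nat -> R) (F C : R) (N : nat -> nat) :
  (forall k, 0 <= a k) ->
  (forall n, \sum_(k < n) a k <= F) ->
  (forall n, n%:R * (F - \sum_(k < N n) a k) <= C) ->
  (\sum_(0 <= k <oo) (a k)%:E)%E = F%:E.
Proof.
move=> a0 aF aC.
have a0E (k : nat) : (0 <= k)%N -> true -> (0 <= (a k)%:E)%E by rewrite lee_fin.
apply/eqP; rewrite eq_le; apply/andP; split.
  apply: lime_le; first exact: is_cvg_nneseries.
  by apply: nearW => n; rewrite sumEFin lee_fin big_mkord.
apply/lee_addgt0Pr => e e0.
(* The error after [N n] terms is at most [e] once [C <= n * e]. *)
pose n := (Num.truncn (C / e)).+1.
apply: (@le_trans _ _ ((\sum_(k < N n) a k)%:E + e%:E)%E); last first.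
  apply: leeD2r; rewrite -(big_mkord xpredT a) -sumEFin.
  exact: nneseries_lim_ge.
rewrite -EFinD lee_fin -lerBlDl.
have n0 : 0 < n%:R :> R by rewrite ltr0n.
rewrite -(ler_pM2l n0); apply: (le_trans (aC n)).
by rewrite -ler_pdivrMr// ltW// truncnS_gt.
Qed.

Lemma step_prob_ge0 (R : realType) (G : sgraph) (x y : G) : 0 <= step_prob R x y.
Proof. by rewrite /step_prob; case: ifP. Qed.

Lemma step_mean (R : realType) (G : sgraph) (x : G) (f : G -> R) :
  \sum_y step_prob R x y * f y = (\sum_(y | adj x y) f y) / (degree x)%:R.
Proof.
rewrite mulrC big_distrr /= [RHS]big_mkcond /=; apply: eq_bigr => y _.
by rewrite /step_prob; case: ifP => //; rewrite mul0r.
Qed.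

Lemma sum_adj_const (R : realType) (G : sgraph) (x : G) (c : R) :
  \sum_(y | adj x y) c = (degree x)%:R * c.
Proof. by rewrite sumr_const /degree cardsE mulr_natl. Qed.

Lemma step_prob_sum1 (R : realType) (G : sgraph) (x : G) :
  (0 < degree x)%N -> \sum_y step_prob R x y = 1.
Proof.
move=> d0; under eq_bigr do rewrite -[step_prob _ _ _]mulr1.
by rewrite step_mean sum_adj_const mulr1 divff// pnatr_eq0 -lt0n.
Qed.

Lemma walk_prob_ge0 (R : realType) (G : sgraph) (x : G) (w : seq G) :
  0 <= walk_prob R x w.
Proof. by elim: w x => //= y w IH x; rewrite mulr_ge0 ?step_prob_ge0. Qed.

Lemma hit_prob_ge0 (R : realType) (G : sgraph) (i j : G) k : 0 <= hit_prob R i j k.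
Proof. by apply: sumr_ge0 => w _; exact: walk_prob_ge0. Qed.

Lemma hit_prob0 (R : realType) (G : sgraph) (i j : G) :
  hit_prob R i j 0 = (i == j)%:R.
Proof.
rewrite /hit_prob (eq_bigl (fun=> i == j)); last by move=> w; rewrite tuple0 /= andbT.
case: eqP => _; last by rewrite big_pred0.
rewrite (eq_bigr (fun=> 1)) => [|w _]; last by rewrite tuple0.
by rewrite sumr_const card_tuple expn0.
Qed.

Lemma hit_prob_self (R : realType) (G : sgraph) (j : G) k :
  hit_prob R j j k.+1 = 0.
Proof.
by apply: big1 => w; case: (tupleP w) => y t; rewrite /= inE eqxx /= andbF.
Qed.

Lemma hit_probS (R : realType) (G : sgraph) (i j : G) k : i != j ->
  hit_prob R i j k.+1 = \sum_y step_prob R i y * hit_prob R y j k.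
Proof.
move=> ij; rewrite /hit_prob.
under [RHS]eq_bigr do rewrite big_distrr /=.
rewrite pair_big_dep /=.
rewrite (reindex (fun p : G * k.-tuple G => cons_tuple p.1 p.2)) /=; last first.
  exists (fun w : k.+1.-tuple G => (thead w, behead_tuple w)).
    by case=> y t _; congr (_, _); apply: val_inj.
  by move=> w _; case: (tupleP w) => y t; apply: val_inj.
apply: eq_bigl => -[y t] /=.
by rewrite inE negb_or (eq_sym j) ij.
Qed.

(** The probability that the walk from [i] reaches [j] after time [n], or never. *)
Definition tail_prob (R : realType) (G : sgraph) (j : G) (n : nat) (i : G) : R :=
  1 - \sum_(k < n.+1) hit_prob R i j k.

Lemma tail_prob0 (R : realType) (G : sgraph) (j i : G) :
  tail_prob R j 0 i = (i != j)%:R.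
Proof.
by rewrite /tail_prob big_ord1 hit_prob0; case: eqP; rewrite ?subrr ?subr0.
Qed.

Lemma tail_probSr (R : realType) (G : sgraph) (j i : G) n :
  tail_prob R j n.+1 i = tail_prob R j n i - hit_prob R i j n.+1.
Proof. by rewrite /tail_prob [in LHS]big_ord_recr /= opprD addrA. Qed.

Lemma tail_prob_self (R : realType) (G : sgraph) (j : G) n :
  tail_prob R j n j = 0.
Proof.
elim: n => [|n IH]; first by rewrite tail_prob0 eqxx.
by rewrite tail_probSr IH hit_prob_self subrr.
Qed.

Lemma tail_probS (R : realType) (G : sgraph) (j i : G) n :
  i != j -> (0 < degree i)%N ->
  tail_prob R j n.+1 i = \sum_y step_prob R i y * tail_prob R j n y.
Proof.
move=> ij d0; rewrite /tail_prob.
under [RHS]eq_bigr do rewrite mulrBr mulr1.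
rewrite sumrB step_prob_sum1//; congr (_ - _).
rewrite big_ord_recl hit_prob0 (negbTE ij) add0r.
under eq_bigr do rewrite lift0 hit_probS//.
by rewrite exchange_big; apply: eq_bigr => y _; rewrite big_distrr.
Qed.

Lemma tail_prob_le (R : realType) (G : sgraph) (j i : G) m n :
  (m <= n)%N -> tail_prob R j n i <= tail_prob R j m i.
Proof.
elim: n => [|n IH]; first by rewrite leqn0 => /eqP ->.
rewrite leq_eqVlt => /predU1P[->//|/IH]; apply: le_trans.
by rewrite tail_probSr gerBl hit_prob_ge0.
Qed.

(** Degrees are required to be positive away from [j]: at an isolated vertex
    [step_prob] is identically 0 and so is not a probability distribution. *)
Definition first_step_eqs (R : realType) (G : sgraph) (j : G) (f : G -> R) :=
  f j = 0 /\ forall i, i != j ->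
    (0 < degree i)%N /\ f i = 1 + \sum_y step_prob R i y * f y.

(** Minimum principle: at a minimum other than [j] the value would be at least
    one more than an average of values that are not smaller. *)
Lemma first_step_ge0 (R : realType) (G : sgraph) (j : G) (f : G -> R) :
  first_step_eqs j f -> forall i, 0 <= f i.
Proof.
move=> [fj fS] i.
have [i0 _ min0] := @arg_minP _ _ _ j xpredT f isT.
have [i0j|/fS[d0 fi0]] := eqVneq i0 j; first by rewrite -fj -i0j; exact: min0.
suff : 1 + f i0 <= f i0 by rewrite gerDr ler10.
rewrite {2}fi0 lerD2l -[leLHS]mul1r -(step_prob_sum1 R d0) big_distrl.
by apply: ler_sum => y _; rewrite ler_wpM2l ?step_prob_ge0 ?min0.
Qed.

(** The series defining the hitting time is compared with an arbitrary solution
    [f] of the first-step equations: such an [f] is nonnegative and bounds the sum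
    of the tails, and, tails being nonincreasing, this forces them to be
    [O(1/n)]. *)
Section HittingTime.
Variables (R : realType) (G : sgraph) (j : G) (f : G -> R).
Hypothesis fE : first_step_eqs j f.

Lemma tail_prob_ge0 n i : 0 <= tail_prob R j n i.
Proof.
elim: n i => [|n IH] i; first by rewrite tail_prob0.
have [->|ij] := eqVneq i j; first by rewrite tail_prob_self.
rewrite tail_probS//; last by case: fE => _ /(_ _ ij)[].
by apply: sumr_ge0 => y _; rewrite mulr_ge0 ?step_prob_ge0.
Qed.

(** What is left of [f] after [n] steps. It obeys the same recursion as
    [tail_prob], started from [f] instead of the indicator of being away from [j]. *)
Definition residual n i := f i - \sum_(l < n) tail_prob R j l i.

Lemma residual_self n : residual n j = 0.
Proof.
rewrite /residual fE.1 big1 ?subrr// => l _; exact: tail_prob_self.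
Qed.

Lemma residualS n i : i != j ->
  residual n.+1 i = \sum_y step_prob R i y * residual n y.
Proof.
move=> ij; have [d0 fi] := fE.2 _ ij.
under eq_bigr do rewrite mulrBr big_distrr.
rewrite sumrB exchange_big /= /residual big_ord_recl tail_prob0 ij.
under [in LHS]eq_bigr do rewrite lift0 tail_probS//.
rewrite {1}fi mulr1n; ring.
Qed.

(** Both sequences are iterates of the same positive operator, so the inequality
    between them at time 0 persists. *)
Lemma residual_bounds (M : R) : (forall i, f i <= M) ->
  forall n i, 0 <= residual n i <= M * tail_prob R j n i.
Proof.
move=> fM; elim=> [|n IH] i.
  rewrite /residual big_ord0 subr0 (first_step_ge0 fE) tail_prob0.
  by have [->|_] := eqVneq i j; rewrite ?fE.1 ?mulr0 ?mulr1 ?lexx ?fM.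
have [->|ij] := eqVneq i j; first by rewrite residual_self tail_prob_self mulr0 lexx.
have [d0 _] := fE.2 _ ij; rewrite residualS// tail_probS//; apply/andP; split.
  apply: sumr_ge0 => y _; rewrite mulr_ge0 ?step_prob_ge0//.
  by case/andP: (IH y).
rewrite big_distrr /=; apply: ler_sum => y _; rewrite mulrCA ler_wpM2l ?step_prob_ge0//.
by case/andP: (IH y).
Qed.

(** Summation by parts. *)
Lemma partial_expectation n i :
  \sum_(k < n.+1) k%:R * hit_prob R i j k
  = \sum_(l < n) tail_prob R j l i - n%:R * tail_prob R j n i.
Proof.
elim: n => [|n IH]; first by rewrite big_ord1 big_ord0 !mul0r subr0.
rewrite big_ord_recr IH /= [in RHS]big_ord_recr /= tail_probSr -natr1; ring.
Qed.

Lemma tail_sum_ge a n i :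
  n%:R * tail_prob R j (a + n) i <= \sum_(l < n) tail_prob R j (a + l) i.
Proof.
rewrite mulr_natl -[X in _ *+ X]card_ord -sumr_const; apply: ler_sum => l _.
by apply: tail_prob_le; rewrite leq_add2l ltnW.
Qed.

(** Let [g] be the tail, [u] the residual and [M] a bound on [f]. The truncated
    expectation at time [2n] misses [f] by [u (2n) + 2 n g (2n)]. Since the sums of [g] are
    bounded by [M], monotonicity gives [n g n <= M]; since moreover
    [u n <= M g n], it also gives [n g (2n) <= u n <= M g n]. Hence the error is
    at most [3 M ^ 2 / n], and the walk almost surely hits [j]. *)
Lemma hitting_timeE i : hitting_time R i j = (f i)%:E.
Proof.
pose M := \sum_x f x.
have f0 := first_step_ge0 fE.
have fM x : f x <= M.
  by rewrite /M (bigD1 x)//= lerDl sumr_ge0.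
have M0 : 0 <= M by exact: sumr_ge0.
have res := residual_bounds fM.
have tail_sum n : \sum_(l < n) tail_prob R j l i <= f i.
  by have /andP[] := res n i; rewrite subr_ge0.
have tailM n : n%:R * tail_prob R j n i <= M.
  by apply: le_trans (tail_sum_ge 0 n i) (le_trans (tail_sum n) _).
have hit1 : (\sum_(0 <= k <oo) (hit_prob R i j k)%:E)%E = 1%:E.
  apply: (@eseries_squeeze _ _ _ M S) => [k|[|n]|n]; first exact: hit_prob_ge0.
  - by rewrite big_ord0 ler01.
  - by rewrite -subr_ge0; exact: tail_prob_ge0.
  - exact: tailM.
rewrite /hitting_time hit1 subee// mule0 adde0.
under eq_eseriesr do rewrite -EFinM.
apply: (@eseries_squeeze _ _ _ (3 * M ^+ 2) (fun n => (n + n).+1)).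
- by move=> k; rewrite mulr_ge0 ?hit_prob_ge0.
- case=> [|n]; first by rewrite big_ord0.
  rewrite partial_expectation; apply: le_trans (tail_sum n).
  by rewrite gerBl mulr_ge0 ?tail_prob_ge0.
move=> n; rewrite partial_expectation opprB addrCA addrC -/(residual _ _).
(* The tails from [n] to [2n] sum to [residual n - residual (2n)]. *)
have half : n%:R * tail_prob R j (n + n) i <= M * tail_prob R j n i.
  apply: le_trans (tail_sum_ge n n i) _.
  have /andP[_] := res n i; apply: le_trans.
  have /andP[] := res (n + n)%N i.
  by rewrite /residual big_split_ord /= => + _; lra.
have h1 : n%:R * residual (n + n) i <= M ^+ 2.
  have /andP[_ h] := res (n + n)%N i.
  apply: le_trans (ler_wpM2l (ler0n _ n) h) _.
  rewrite mulrCA expr2 ler_wpM2l//; apply: le_trans (tailM n).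
  by rewrite ler_wpM2l//; apply: tail_prob_le; rewrite leq_addr.
have h2 : n%:R * (n%:R * tail_prob R j (n + n) i) <= M ^+ 2.
  apply: le_trans (ler_wpM2l (ler0n _ n) half) _.
  by rewrite mulrCA expr2 ler_wpM2l.
rewrite natrD; nra.
Qed.
End HittingTime.

Lemma connected_degree_gt0 (G : sgraph) (i j : G) :
  connected_graph G -> i != j -> (0 < degree i)%N.
Proof.
move=> hG ij; have /connectP[[/= _ ji|y w /= /andP[iy _] _]] := hG i j.
  by rewrite ji eqxx in ij.
by rewrite card_gt0; apply/set0Pn; exists y; rewrite inE.
Qed.

(** Maximum principle: a positive maximum would spread from its vertex to all
    neighbours, hence along a path to [j], where the function vanishes. *)
Lemma harmonic_le0 (R : realType) (G : sgraph) (j : G) (h : G -> R) :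
  connected_graph G -> h j = 0 ->
  (forall i, i != j -> h i = \sum_y step_prob R i y * h y) ->
  forall i, h i <= 0.
Proof.
move=> hG hj hS i.
have [m _ max_m] := @arg_maxP _ _ _ i xpredT h isT.
apply: le_trans (max_m i isT) _; rewrite leNgt; apply/negP => hm.
have spread x y : adj x y -> h x = h m -> h y = h m.
  move=> xy xm; have xj : x != j.
    by apply/eqP => xj; rewrite -xm xj hj ltxx in hm.
  have d0 := connected_degree_gt0 hG xj.
  have p0 : step_prob R x y != 0.
    by rewrite /step_prob xy invr_eq0 pnatr_eq0 -lt0n.
  have : \sum_z step_prob R x z * (h m - h z) = 0.
    under eq_bigr do rewrite mulrBr.
    by rewrite sumrB -hS// xm -big_distrl step_prob_sum1//= mul1r subrr.
  move/psumr_eq0P => /(_ _ y isT) /eqP.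
  rewrite mulf_eq0 (negbTE p0) subr_eq0 => /(_ _)/eqP -> // z _.
  by rewrite mulr_ge0 ?step_prob_ge0// subr_ge0; exact: max_m.
have spread_path w x : path (@adj G) x w -> h x = h m -> h (last x w) = h m.
  by elim: w x => //= y w IH x /andP[xy yw] xm; apply: IH yw _; exact: spread xy xm.
have /connectP[w mw jE] := hG m j.
by have := spread_path w m mw erefl; rewrite -jE hj => h0; rewrite -h0 ltxx in hm.
Qed.

(** The first-step equations are a square linear system, whose kernel is trivial
    by the maximum principle applied to a function and to its opposite. *)
Lemma first_step_exists (R : realType) (G : sgraph) (j : G) :
  connected_graph G -> exists f : G -> R, first_step_eqs j f.
Proof.
move=> hG.
pose L (h : {ffun G -> R^o}) : {ffun G -> R^o} :=
  [ffun i => h i - (if i == j then 0 else \sum_y step_prob R i y * h y)].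
have linL : linear L.
  move=> a g h; apply/ffunP => i; rewrite !ffunE.
  case: ifP => _; first by rewrite !subr0.
  under eq_bigr do rewrite !ffunE mulrDr.
  rewrite big_split /= scalerBr opprD addrACA scaler_sumr.
  by congr (_ - _ + _); apply: eq_bigr => y _; exact: mulrCA.
pose Llin := GRing.isLinear.Build R _ _ _ L linL.
pose LL : {linear {ffun G -> R^o} -> {ffun G -> R^o}} := HB.pack L Llin.
have LE i h : linfun LL h i = h i - (if i == j then 0 else \sum_y step_prob R i y * h y).
  by rewrite lfunE /= ffunE.
have ker0 : lker (linfun LL) == 0%VS.
  apply/lker0P => g h /ffunP gh.
  have eqs i : g i - h i = if i == j then 0 else \sum_y step_prob R i y * (g y - h y).
    have := gh i; rewrite !LE; case: ifP => _.
      by rewrite !subr0 => ->; rewrite subrr.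
    move=> E; under [RHS]eq_bigr do rewrite mulrBr.
    by rewrite sumrB; lra.
  apply/ffunP => i; apply/eqP; rewrite eq_le; apply/andP; split; rewrite -subr_le0.
    apply: (harmonic_le0 (j := j) (h := fun i => g i - h i)) => // [|k /negbTE kj].
      by rewrite eqs eqxx.
    by rewrite eqs kj.
  apply: (harmonic_le0 (j := j) (h := fun i => h i - g i)) => // [|k /negbTE kj].
    by apply/eqP; rewrite -opprB eqs eqxx oppr0.
  rewrite -[LHS]opprB eqs kj -sumrN; apply: eq_bigr => y _.
  by rewrite -mulrN opprB.
pose b : {ffun G -> R^o} := [ffun i => (i != j)%:R].
have /memv_imgP[f _ bE] : b \in limg (linfun LL) by rewrite lker0_limgf// memvf.
have fS i : f i = (i != j)%:R + (if i == j then 0 else \sum_y step_prob R i y * f y).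
  by have := LE i f; rewrite -bE ffunE => ->; rewrite subrK.
exists f; split=> [|i ij]; first by rewrite fS eqxx addr0.
split; first exact: connected_degree_gt0 hG ij.
by rewrite {1}fS (negbTE ij).
Qed.

(** * Degree-weighted equations and edge counting *)

(** The form in which the equations are checked on the triangulation: sums over
    neighbours, without division. *)
Lemma first_step_eqsP (R : realType) (G : sgraph) (j : G) (f : G -> R) :
  first_step_eqs j f <-> f j = 0 /\ forall i, i != j -> (0 < degree i)%N /\
    (degree i)%:R * f i = (degree i)%:R + \sum_(y | adj i y) f y.
Proof.
split=> -[fj fS]; split=> // i /fS[d0 fi]; split=> //;
  have d0' : (degree i)%:R != 0 :> R by rewrite pnatr_eq0 -lt0n.
  by rewrite fi step_mean; field.
by apply: (mulfI d0'); rewrite fi step_mean; field.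
Qed.

(** The return-time formula: the mean return time to [j] is the total degree
    over the degree of [j]. Multiplying the first-step equations by the degrees
    and summing over all vertices cancels everything except the terms at [j],
    because the adjacency relation is symmetric. *)
Lemma sum_adj_target (R : realType) (G : sgraph) (j : G) (f : G -> R) :
  first_step_eqs j f ->
  \sum_(y | adj j y) f y = \sum_(x : G) (degree x)%:R - (degree j)%:R.
Proof.
move=> /first_step_eqsP[fj fS].
have : \sum_(x : G) (degree x)%:R * f x = \sum_x \sum_(y | adj x y) f y.
  under [RHS]eq_bigr do rewrite big_mkcond.
  rewrite exchange_big; apply: eq_bigr => x _.
  rewrite -sum_adj_const [LHS]big_mkcond /=; apply: eq_bigr => y _.
  by rewrite adj_sym.
rewrite [LHS](bigD1 j)//= [RHS](bigD1 j)//= fj mulr0 add0r.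
under eq_bigr => i ij do rewrite (fS i ij).2.
rewrite big_split /= [\sum_x _](bigD1 j)//= => E; lra.
Qed.

Lemma edge_pair (G : sgraph) (e : {set G}) :
  e \in edges G -> exists x y, adj x y /\ e = [set x; y].
Proof. by case/imset2P => x y _; rewrite inE /= => xy ->; exists x, y. Qed.

Lemma edges_adj (G : sgraph) (x y : G) : adj x y -> [set x; y] \in edges G.
Proof. by move=> xy; apply/imset2P; exists x y; rewrite ?inE. Qed.

Lemma adj_neq (G : sgraph) (x y : G) : adj x y -> x != y.
Proof. by apply: contraTneq => ->; rewrite adj_irr. Qed.

Lemma card_edge (G : sgraph) (e : {set G}) : e \in edges G -> #|e| = 2%N.
Proof. by case/edge_pair => x [y [/adj_neq xy ->]]; rewrite cards2 xy. Qed.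

(** An edge through [x] is determined by its other endpoint. *)
Lemma sum_incident (R : realType) (G : sgraph) (x : G) (H : {set G} -> R) :
  \sum_(e in edges G | x \in e) H e = \sum_(y | adj x y) H [set x; y].
Proof.
have -> : \sum_(e in edges G | x \in e) H e
    = \sum_(e in [set [set x; y] | y in neighbors x]) H e.
  apply: eq_bigl => e; apply/andP/imsetP => [[/edge_pair[a [b [ab ->]]]]|].
    case/set2P => ->; [exists b|exists a]; rewrite ?[_ \in _]inE// ?(adj_sym b)//.
    exact: finset.setUC.
  by case=> y; rewrite inE => xy ->; rewrite edges_adj// set21.
rewrite big_imset => [|y z]; first by apply: eq_bigl => y; rewrite inE.
rewrite !inE => /adj_neq xy _ /setP/(_ y).
by rewrite !inE eqxx orbT eq_sym (negbTE xy) => /esym/eqP.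
Qed.

(** Double counting of the incident pairs of a vertex and an edge. *)
Lemma handshake (R : realType) (G : sgraph) :
  \sum_(x : G) (degree x)%:R = 2 * #|edges G|%:R :> R.
Proof.
transitivity (\sum_(x : G) \sum_(e in edges G | x \in e) (1 : R)).
  by apply: eq_bigr => x _; rewrite (sum_incident x (fun=> 1)) sum_adj_const mulr1.
rewrite (exchange_big_dep (mem (edges G))) //=; last by move=> x e _ /andP[].
rewrite (eq_bigr (fun=> 2)) => [|e eG]; last first.
  rewrite (eq_bigl (mem e)) => [|x]; last by rewrite eG.
  by rewrite sumr_const card_edge.
by rewrite sumr_const -[LHS]mulr_natr.
Qed.

(** * Walks on the triangulation *)
Lemma sum_adj_old (R : realType) (q : nat) (G : sgraph) (x : G)
    (F : triangulation q G -> R) :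
  \sum_(y | adj (old_vertex x) y) F y =
  \sum_(y | adj x y) F (old_vertex y)
  + \sum_(p : new_node q G | x \in val p.1) F (new_vertex p).
Proof. by rewrite big_sumType. Qed.

Lemma sum_adj_new (R : realType) (q : nat) (G : sgraph) (p : new_node q G)
    (F : triangulation q G -> R) :
  \sum_(y | adj (new_vertex p) y) F y = \sum_(v in val p.1) F (old_vertex v).
Proof. by rewrite big_sumType /= [X in _ + X]big_pred0 ?addr0. Qed.

Lemma sum_incident_new (R : realType) (q : nat) (G : sgraph) (x : G)
    (H : {set G} -> R) :
  \sum_(p : new_node q G | x \in val p.1) H (val p.1)
  = q%:R * \sum_(y | adj x y) H [set x; y].
Proof.
rewrite -sum_incident big_sub_cond big_distrr /=.
transitivity (\sum_(e : {e : {set G} | e \in edges G} | x \in val e)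
    \sum_(k < q) H (val e)).
  by rewrite pair_big /=; apply: eq_bigl => p; rewrite andbT.
by apply: eq_bigr => e _; rewrite sumr_const card_ord mulr_natl.
Qed.

Lemma degree_old (R : realType) (q : nat) (G : sgraph) (x : G) :
  (degree (old_vertex x : triangulation q G))%:R = (1 + q%:R) * (degree x)%:R :> R.
Proof.
rewrite -[LHS]mulr1 -sum_adj_const sum_adj_old (sum_incident_new q x (fun=> 1)).
by rewrite !sum_adj_const; ring.
Qed.

Lemma degree_new (q : nat) (G : sgraph) (p : new_node q G) :
  degree (new_vertex p) = 2%N.
Proof.
rewrite -(card_edge (valP p.1)) -(card_imset _ (@inl_inj G (new_node q G))).
apply: eq_card => -[y|r]; rewrite inE /=.
  by rewrite mem_imset//; exact: inl_inj.
by apply/esym/imsetP => -[].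
Qed.

(** From a new node the walk has to step to one of its two endpoints, so the
    first-step equations force the values there from the values [h] on the
    old vertices. *)
Definition tri_ext (R : realType) (q : nat) (G : sgraph) (h : G -> R)
    (y : triangulation q G) : R :=
  match y with
  | inl v => h v
  | inr p => 1 + (\sum_(v in val p.1) h v) / 2
  end.

Lemma sum_set2 (R : realType) (G : sgraph) (s t : G) (h : G -> R) : s != t ->
  \sum_(v in [set s; t]) h v = h s + h t.
Proof. by move=> st; rewrite big_setU1 ?inE//= big_set1. Qed.

(** Eliminating the new nodes: around an old vertex, [tri_ext h] only sees
    [h x] and the neighbour sum of [h] in the original graph. *)
Lemma sum_adj_old_ext (R : realType) (q : nat) (G : sgraph) (x : G) (h : G -> R) :
  \sum_(y | adj (old_vertex x) y) @tri_ext R q G h y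
  = (1 + q%:R / 2) * \sum_(y | adj x y) h y
    + q%:R * (degree x)%:R * (1 + h x / 2).
Proof.
rewrite sum_adj_old /= (sum_incident_new q x (fun e => 1 + (\sum_(v in e) h v) / 2)).
have -> : \sum_(y | adj x y) (1 + (\sum_(v in [set x; y]) h v) / 2)
   = \sum_(y | adj x y) (1 + h x / 2) + (\sum_(y | adj x y) h y) / 2.
  rewrite big_distrl -big_split /=; apply: eq_bigr => y /adj_neq xy.
  by rewrite sum_set2//; ring.
rewrite sum_adj_const; ring.
Qed.

(** Making [z] the target changes the value only at [z]: the correction to the
    equations is confined to the neighbours of [z]. *)
Lemma sum_adj_hole (R : realType) (G : sgraph) (x z : G) (f : G -> R) :
  \sum_(y | adj x y) (if y == z then 0 else f y)
  = \sum_(y | adj x y) f y - (if adj x z then f z else 0).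
Proof.
case: ifPn => xz; last first.
  rewrite subr0; apply: eq_bigr => y xy; case: eqP => // yz.
  by rewrite -yz xy in xz.
rewrite [LHS](bigD1 z)//= [X in X - _](bigD1 z)//= eqxx add0r addrC addrK.
by apply: eq_bigr => y /andP[_ /negbTE ->].
Qed.

(** With the new nodes eliminated, the equation at an old vertex becomes
    [h i = c + (mean of h over the neighbours of i)] with
    [c = (4q + 2) / (q + 2)], i.e. the equation of the original graph scaled
    by [c]. *)
Lemma tri_ext_old_target (R : realType) (q : nat) (G : sgraph) (j : G) (f : G -> R) :
  first_step_eqs j f ->
  first_step_eqs (old_vertex j : triangulation q G)
    (@tri_ext R q G (fun i => (4 * q%:R + 2) / (q%:R + 2) * f i)).
Proof.
have q0 : q%:R + 2 != 0 :> R by rewrite gt_eqF// ltr_wpDl.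
move=> /first_step_eqsP[fj fS]; apply/first_step_eqsP; split=> [|[i|p] ij].
- by rewrite /= fj mulr0.
- have [d0 fi] := fS i ij; split.
    by rewrite -(ltr0n R) degree_old mulr_gt0 ?ltr0n// ltr_wpDr.
  rewrite degree_old sum_adj_old_ext -big_distrr /=.
  have -> : \sum_(y | adj i y) f y = (degree i)%:R * f i - (degree i)%:R.
    by rewrite fi addrAC subrr add0r.
  by field.
rewrite degree_new sum_adj_new /=; split=> //; by field.
Qed.

(** Away from [s] and [t] the function [h] must drop by [c] on average, as for an
    old target; [2 (fs + ft)] drops by 4 and its coefficient is [c / 4]. At
    [s] the equation changes in two ways: the target contributes 0 instead of
    its forced value, and the neighbour sum of [fs] is given by the return-time
    formula. These two corrections balance, and likewise at [t], exactly when
    the average of [h s] and [h t] is [m (2q + 1) - 1], which fixes the additive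
    constant; the term [fs t + ft s] is subtracted so that this average is the
    constant itself. *)
Lemma tri_ext_new_target (R : realType) (q : nat) (G : sgraph)
    (p : new_node q G) (s t : G) (fs ft : G -> R) :
  connected_graph G -> s != t -> val p.1 = [set s; t] ->
  first_step_eqs s fs -> first_step_eqs t ft ->
  let Q : R := q%:R in let m : R := #|edges G|%:R in
  let h i := m * (2 * Q + 1) - 1
    + (2 * Q + 1) / (2 * (Q + 2)) * (2 * (fs i + ft i) - (fs t + ft s)) in
  first_step_eqs (new_vertex p) (fun y => if y == new_vertex p then 0 else tri_ext h y).
Proof.
move=> hG st pst fsE ftE Q m h.
have q0 : Q + 2 != 0 by rewrite gt_eqF// ltr_wpDl ?ler0n.
have sum_s := sum_adj_target fsE.
have sum_t := sum_adj_target ftE.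
have /first_step_eqsP[fss fsS] := fsE.
have /first_step_eqsP[ftt ftS] := ftE.
rewrite handshake -/m in sum_s sum_t.
have sumh i : \sum_(y | adj i y) h y = (degree i)%:R * (m * (2 * Q + 1) - 1
    - (2 * Q + 1) / (2 * (Q + 2)) * (fs t + ft s))
    + (2 * Q + 1) / (Q + 2) * (\sum_(y | adj i y) fs y + \sum_(y | adj i y) ft y).
  rewrite -sum_adj_const -big_split /= big_distrr -big_split /=.
  by apply: eq_bigr => y _; rewrite /h; field.
(* [s] and [t] are two vertices, so connectivity rules out isolated ones. *)
have d0 (i : G) : (0 < degree i)%N.
  have [->|] := eqVneq i s; first exact: connected_degree_gt0 hG st.
  exact: connected_degree_gt0.
apply/first_step_eqsP; split=> [|[i|r] ip]; first by rewrite eqxx.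
  split; first by rewrite -(ltr0n R) degree_old mulr_gt0 ?ltr0n// ltr_wpDr.
  rewrite sum_adj_hole sum_adj_old_ext sumh degree_old -/Q /=.
  rewrite pst sum_set2// in_set2.
  have [->|is_] := eqVneq i s.
    rewrite /= sum_s.
    have -> : \sum_(y | adj s y) ft y = (degree s)%:R * ft s - (degree s)%:R.
      by rewrite (ftS s st).2 addrAC subrr add0r.
    by rewrite /h fss ftt; field.
  have -> : \sum_(y | adj i y) fs y = (degree i)%:R * fs i - (degree i)%:R.
    by rewrite (fsS i is_).2 addrAC subrr add0r.
  have [->|it] := eqVneq i t.
    by rewrite /= sum_t /h fss ftt; field.
  have -> : \sum_(y | adj i y) ft y = (degree i)%:R * ft i - (degree i)%:R.
    by rewrite (ftS i it).2 addrAC subrr add0r.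
  by rewrite /= /h; field.
rewrite degree_new sum_adj_new (negbTE ip) /=; split=> //; by field.
Qed.

Lemma neighbors_newE (q : nat) (G : sgraph) (p : new_node q G) (s t : G) :
  neighbors (new_vertex p) = [set old_vertex s; old_vertex t] ->
  s != t /\ val p.1 = [set s; t].
Proof.
move=> E; have pE : val p.1 = [set s; t].
  by apply/setP => x; move/setP/(_ (old_vertex x)): E; rewrite !inE.
split=> //; have := card_edge (valP p.1); rewrite /= pE cards2.
by case: eqP.
Qed.

Theorem theorem3 (R : realType) (G : sgraph) (q : nat)
    (hconn : connected_graph G) (hq : (0 < q)%N) :
  let m : R := #|edges G|%:R in
  let Q : R := q%:R in
  let T := fun i j : G => hitting_time R i j in
  let T' := fun i j : triangulation q G => hitting_time R i j in
  [/\ forall i j : G,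
        T' (old_vertex i) (old_vertex j) =
          (((4 * Q + 2) / (Q + 2))%:E * T i j)%E,
      forall (i : new_node q G) (j s t : G),
        neighbors (new_vertex i) = [set old_vertex s; old_vertex t] ->
        T' (new_vertex i) (old_vertex j) =
          (1 + ((2 * Q + 1) / (Q + 2))%:E * (T s j + T t j))%E /\
        T' (old_vertex j) (new_vertex i) =
          ((m * (2 * Q + 1) - 1)%:E
           + ((2 * Q + 1) / (2 * (Q + 2)))%:E
             * (2%:E * (T j s + T j t) - (T t s + T s t)))%E
    & forall (i j : new_node q G) (s t u v : G),
        i != j ->
        neighbors (new_vertex i) = [set old_vertex s; old_vertex t] ->
        neighbors (new_vertex j) = [set old_vertex u; old_vertex v] ->
        T' (new_vertex i) (new_vertex j) =
          ((m * (2 * Q + 1))%:E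
           + ((2 * Q + 1) / (2 * (Q + 2)))%:E
             * (T s u + T t u + T s v + T t v - (T u v + T v u)))%E].
Proof.
move=> m Q T T'.
(* [t j i] is the real number that is the hitting time from [i] to [j] in [G]. *)
have [t tE] := choice (fun j => @first_step_exists R G j hconn).
have q0 : Q + 2 != 0 by rewrite gt_eqF// ltr_wpDl ?ler0n.
have TE i j : T i j = (t j i)%:E := hitting_timeE (tE j) i.
have T'_old y j := hitting_timeE (tri_ext_old_target q (tE j)) y.
split=> [i j|i j s u|i j s u v w ij].
- by rewrite /T' T'_old TE.
- move=> /neighbors_newE[su iE]; split.
    rewrite /T' T'_old /= iE sum_set2// !TE -!EFinD -?EFinM -/Q; congr _%:E.
    by field.
  rewrite /T' (hitting_timeE (tri_ext_new_target hconn su iE (tE s) (tE u))) /=.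
  by rewrite !TE.
move=> /neighbors_newE[su iE] /neighbors_newE[vw jE].
rewrite /T' (hitting_timeE (tri_ext_new_target hconn vw jE (tE v) (tE w))).
have -> : (new_vertex i == new_vertex j) = false.
  by apply/negbTE; apply: contraNneq ij => -[->].
rewrite /= iE sum_set2// !TE -!EFinD -/Q; congr _%:E.
by field.
Qed.
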